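(* Let $\mathcal{H}$ be a separable Hilbert space, let $K\in B(\mathcal{H})$ be an operator with closed range $\mathcal{R}_K$, let $C,C'\in GL(\mathcal{H})$, and let $\mathcal{W}=\{W_i,w_i\}_{i\in I}$ be a $(C,C')$-controlled $K$-fusion frame for $\mathcal{H}$ with lower and upper bounds $A_{CC'}$ and $B_{CC'}$, respectively. Let $\{V_i\}_{i\in I}$ be a family of closed subspaces of $\mathcal{H}$. If there exists a number $0<R<A_{CC'}$ such that $$0<\sum_{i\in I} w_i^2\langle C'^*(\pi_{V_i}-\pi_{W_i})Cf,f\rangle\le R\|f\|^2\quad\text{for all nonzero } f\in\mathcal{H},$$ then $\mathcal{V}=\{V_i,w_i\}_{i\in I}$ is a $(C,C')$-controlled Bessel $K$-fusion sequence for $\mathcal{H}$ and a $(C,C')$-controlled $K$-fusion frame for $\mathcal{R}_K$.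
   Context: $I$ is a countable index set; $B(\mathcal{H})$ denotes the bounded linear operators on $\mathcal{H}$; $GL(\mathcal{H})$ is the set of bounded invertible operators on $\mathcal{H}$ with bounded inverse; $\pi_W$ is the orthogonal projection of $\mathcal{H}$ onto a closed subspace $W$; weights $w_i$ are positive real numbers. Given $K\in B(\mathcal{H})$, $C,C'\in GL(\mathcal{H})$, closed subspaces $W_i\subseteq\mathcal{H}$ and weights $w_i>0$, the family $\mathcal{W}=\{W_i,w_i\}_{i\in I}$ is a $(C,C')$-controlled $K$-fusion frame for $\mathcal{H}$ with bounds $A_{CC'},B_{CC'}$ if $0<A_{CC'}\le B_{CC'}<\infty$ and $$A_{CC'}\|K^*f\|^2\le\sum_{i\in I}w_i^2\langle\pi_{W_i}Cf,\pi_{W_i}C'f\rangle\le B_{CC'}\|f\|^2\quad\text{for all } f\in\mathcal{H}.$$ If only the right-hand inequality is required (for some finite constant), $\mathcal{W}$ is a $(C,C')$-controlled Bessel $K$-fusion sequence for $\mathcal{H}$. The family is a $(C,C')$-controlled $K$-fusion frame for $\mathcal{R}_K$ if, for some constants $0<A\le B<\infty$, the two inequalities hold for all $f\in\mathcal{R}_K$. *)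

(* Defs.v *)
From HB Require Import structures.
From mathcomp Require Import all_boot all_order all_algebra.
From mathcomp Require Import complex.
From mathcomp Require Import all_classical all_reals all_analysis.
From mathcomp.analysis.showcase Require Import summability.

Set Implicit Arguments.
Unset Strict Implicit.
Unset Printing Implicit Defensive.

Import Order.TTheory GRing.Theory Num.Theory.
Import numFieldNormedType.Exports.

Local Open Scope classical_set_scope.
Local Open Scope ring_scope.

Variant scalar_kind := RealScalars | ComplexScalars.

(* The order of R[i] is partial: x <= y means that y - x is a nonnegative real.
   Hence [0 < a] says that the scalar a is a positive real number, and an
   inequality between a sum and a real number says that the sum is real. *)
Definition scalars (R : realType) (k : scalar_kind) : numFieldType :=
  match k with
  | RealScalars => R
  | ComplexScalars => R[i]
  end.

Definition scalar_conj (R : realType) (k : scalar_kind) :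
    {rmorphism scalars R k -> scalars R k} :=
  match k with
  | RealScalars => idfun
  | ComplexScalars => @conjc R
  end.

(* [hdot] is linear in its first argument and conjugate-linear in the second. *)
Record hilbertSpace (R : realType) (k : scalar_kind) := HilbertSpace {
  hilbert_carrier :> completeNormedModType (scalars R k);
  hdot : {dot hilbert_carrier for scalar_conj R k};
  hdotE : forall x : hilbert_carrier, `|x| ^+ 2 = hdot x x
}.

Notation "''[' u , v ]" := (hdot _ u%R v%R) : ring_scope.

Definition separable_space (T : topologicalType) :=
  exists S : set T, countable S /\ dense S.

Section hilbert.
Context {R : realType} {k : scalar_kind} {H : hilbertSpace R k}.
Local Notation F := (scalars R k).

Definition bounded_operator (T : {linear H -> H}) :=
  exists M : F, forall x, `|T x| <= M * `|x|.

Definition boundedly_invertible (T : {linear H -> H}) :=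
  bounded_operator T /\
  exists S : {linear H -> H}, [/\ bounded_operator S, cancel T S & cancel S T].

Definition closed_subspace (W : set H) :=
  [/\ closed W, W 0 & forall (a : F) x y, W x -> W y -> W (a *: x + y)].

(* The default value 0 is never used when T is a bounded operator (Riesz
   representation), and the representative is then unique. *)
Definition adjoint (T : H -> H) (y : H) : H :=
  xget 0 [set z | forall x, '[T x, y] = '[x, z]].

(* The default value 0 is never used when W is a closed subspace, and the
   vector p is then unique. *)
Definition orth_proj (W : set H) (x : H) : H :=
  xget 0 [set p | W p /\ forall y, W y -> '[x - p, y] = 0].

(* I carries no order, so sums over I are unconditional: limits of the net of
   the partial sums over the finite subsets of I. *)
Definition summable_over (I : countType) (x : I -> F) :=
  cvg (partial_sum (x : I -> F^o) @ totally).

Definition sum_over (I : countType) (x : I -> F) : F := sum (x : I -> F^o).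

Section fusion.
Context {I : countType}.
Implicit Types (D : set H) (K C : {linear H -> H}) (W : I -> set H).
Implicit Types (w : I -> F) (A B : F).

Definition controlled_terms C (C' : {linear H -> H}) W w (f : H)
    (i : I) : F :=
  w i ^+ 2 * '[orth_proj (W i) (C f), orth_proj (W i) (C' f)].

Definition controlled_K_fusion_frame_on D K C (C' : {linear H -> H}) W w A B :=
  0 < A /\ A <= B /\
  forall f, D f ->
    [/\ summable_over (controlled_terms C C' W w f),
        A * `|adjoint K f| ^+ 2 <= sum_over (controlled_terms C C' W w f)
      & sum_over (controlled_terms C C' W w f) <= B * `|f| ^+ 2].

Definition controlled_bessel_K_fusion C (C' : {linear H -> H}) W w :=
  exists B : F, 0 < B /\ forall f,
    summable_over (controlled_terms C C' W w f) /\
    sum_over (controlled_terms C C' W w f) <= B * `|f| ^+ 2.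

End fusion.
End hilbert.

(* Main.v *)
(** Since [pi_V] is a self-adjoint idempotent,
    [<pi_V C f, pi_V C' f> = <C'^* pi_V C f, f>], so the controlled sum of the
    [V_i] is that of the [W_i] plus the perturbation sum, which lies in
    [[0, r |f|^2]]. Hence [A] remains a lower bound and [B + r] is an upper one,
    on all of [H]. The substance is that [pi_V] and [C'^*] are the intended
    operators, i.e. the projection theorem and the Riesz representation
    theorem, over real or complex scalars alike. *)

Require Import Defs.
From HB Require Import structures.
From mathcomp Require Import all_boot all_order all_algebra.
From mathcomp Require Import complex ring.
From mathcomp Require Import all_classical all_reals all_analysis.
From mathcomp.analysis.showcase Require Import summability.

Import Order.TTheory GRing.Theory Num.Theory.
Import numFieldNormedType.Exports.
Local Open Scope classical_set_scope.
Local Open Scope ring_scope.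

(** * Conjugation and greatest lower bounds in the scalar field *)

Section scalars.
Context {R : realType} {k : scalar_kind}.
Local Notation F := (scalars R k).

Lemma mul_scalar_conj (a : F) : a * scalar_conj R k a = `|a| ^+ 2.
Proof.
case: k a => /= a; first by rewrite real_normK ?num_real.
by rewrite sqr_normc.
Qed.

Lemma scalar_conjK : involutive (scalar_conj R k).
Proof. by case: k => // x; exact: conjcK. Qed.

(* The order of R[i] is not total, so greatest lower bounds exist only for
   sets of reals. *)
Lemma scalar_inf (S : set F) : S !=set0 -> (forall s, S s -> 0 <= s) ->
  exists d : F, [/\ 0 <= d, forall s, S s -> d <= s &
    forall e, 0 < e -> exists2 s, S s & s < d + e].
Proof.
case: k S => /= S S0 Sge0.
  have lbS : lbound S 0 by move=> s /Sge0.
  exists (inf S); split.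
  - exact: lb_le_inf.
  - by move=> s Ss; apply: ge_inf => //; exists 0.
  - by move=> e e0; apply: inf_adherent => //; split=> //; exists 0.
(* A nonnegative element of [R[i]] is real, so the infimum is taken among the real parts and
   embedded back. *)
pose T := [set complex.Re s | s in S].
have T0 : T !=set0 by case: S0 => s Ss; exists (complex.Re s); exists s.
have lbT : lbound T 0.
  by move=> _ [s /Sge0 s0 <-]; move: s0; rewrite lecE => /andP[].
have ST s : S s -> s = (complex.Re s)%:C%C.
  move=> /Sge0; rewrite lecE => /andP[/eqP/= + _].
  by case: s => a b /= ->.
exists (inf T)%:C%C; split.
- by rewrite lecR; exact: lb_le_inf.
- move=> s Ss; rewrite (ST _ Ss) lecR.
  by apply: ge_inf; [exists 0|exists s].
- move=> e; rewrite ltcE => /andP[/eqP/= e2 e1].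
  have [|_ [s Ss <-] sd] := @inf_adherent _ T (complex.Re e) e1.
    by split=> //; exists 0.
  exists s => //; rewrite (ST _ Ss) ltcE/=.
  by case: e e2 e1 sd => a b /= -> _ ->; rewrite addr0 eqxx.
Qed.

End scalars.

(** * Inner product identities and the Cauchy-Schwarz inequality *)

Section hilbert.
Context {R : realType} {k : scalar_kind} {H : hilbertSpace R k}.
Local Notation F := (scalars R k).
Implicit Types x y z u v : H.

Lemma hdotC x y : '[x, y] = scalar_conj R k '[y, x].
Proof. by rewrite (hermC (hdot H)) expr0 mul1r. Qed.

Lemma hdotZr (a : F) x y : '[x, a *: y] = scalar_conj R k a * '[x, y].
Proof. exact: (linearZr_LR (hdot H)). Qed.

Lemma hdotZl (a : F) x y : '[a *: x, y] = a * '[x, y].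
Proof. exact: (linearZl_LR (hdot H)). Qed.

Lemma hdotDl x y z : '[x + y, z] = '[x, z] + '[y, z].
Proof. exact: (linearDl (hdot H)). Qed.

Lemma hdotDr x y z : '[x, y + z] = '[x, y] + '[x, z].
Proof. exact: (linearDr (hdot H)). Qed.

Lemma hdotNl x y : '[- x, y] = - '[x, y].
Proof. exact: (linearNl (hdot H)). Qed.

Lemma hdotNr x y : '[x, - y] = - '[x, y].
Proof. exact: (linearNr (hdot H)). Qed.

Lemma hdotBl x y z : '[x - y, z] = '[x, z] - '[y, z].
Proof. exact: (linearBl (hdot H)). Qed.

Lemma hdotBr x y z : '[x, y - z] = '[x, y] - '[x, z].
Proof. exact: (linearBr (hdot H)). Qed.

Lemma hdot0l x : '[0, x] = 0 :> F.
Proof. exact: (linear0l (hdot H)). Qed.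

Lemma hdot0r x : '[x, 0] = 0 :> F.
Proof. exact: (linear0r (hdot H)). Qed.

Lemma parallelogram x y :
  `|x + y| ^+ 2 + `|x - y| ^+ 2 = `|x| ^+ 2 *+ 2 + `|y| ^+ 2 *+ 2.
Proof.
rewrite !hdotE !hdotDl !hdotDr.
rewrite !hdotNl !hdotNr.
ring.
Qed.

(** Pythagoras: the vector subtracted from [x] is its component along [y]. Nonnegativity of the left
    side gives Cauchy-Schwarz; its comparison with a minimal distance gives orthogonality. *)
Lemma norm_sub_proj x y : y != 0 ->
  `|x - ('[x, y] / '[y, y]) *: y| ^+ 2 =
  `|x| ^+ 2 - `|'[x, y]| ^+ 2 / `|y| ^+ 2.
Proof.
move=> y0; have yy : '[y, y] != 0 by rewrite -hdotE expf_neq0 ?normr_eq0.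
rewrite -mul_scalar_conj !hdotE.
rewrite hdotBl !hdotBr !hdotZl !hdotZr.
rewrite rmorphM fmorphV -!hdotC divfK// subrr subr0.
by rewrite mulrAC [_ * '[x, y]]mulrC.
Qed.

Lemma hdot_cauchy_schwarz x y : `|'[x, y]| <= `|x| * `|y|.
Proof.
have [->|y0] := eqVneq y 0.
  by rewrite hdot0r !normr0 mulr0.
have := exprn_ge0 2 (normr_ge0 (x - ('[x, y] / '[y, y]) *: y)).
rewrite norm_sub_proj// subr_ge0 ler_pdivrMr ?exprn_gt0 ?normr_gt0//.
by rewrite -exprMn ler_pXn2r ?nnegrE ?mulr_ge0.
Qed.

(** * Projection theorem *)

Lemma closed_subspaceD W x y :
  closed_subspace W -> W x -> W y -> W (x + y :> H).
Proof. by case=> _ _ WP Wx Wy; rewrite -[x]scale1r; exact: WP. Qed.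

Lemma closed_subspaceZ W (a : F) x :
  closed_subspace W -> W x -> W (a *: x :> H).
Proof. by case=> _ W0 WP Wx; rewrite -[_ *: _]addr0; exact: WP. Qed.

Lemma midpoint_sub x y z : (x - y) + (x - z) = 2 *: (x - 2^-1 *: (y + z)).
Proof.
rewrite scalerBr scalerA divff ?pnatr_eq0// scale1r scaler_nat mulr2n.
by rewrite opprD addrACA.
Qed.

(** The sets [S e] of points of [W] within [d + e] of [x], with [d] the distance from [x] to [W],
    generate a filter. The parallelogram law makes it Cauchy, and its limit is the nearest point. *)
Lemma exists_nearest_point W x : closed_subspace W ->
  exists2 p, W p & forall y, W y -> `|x - p| <= `|x - y|.
Proof.
move=> subW; have [clW W0 _] := subW.
have [||d [d0 dW dinf]] := @scalar_inf R k [set `|x - y| | y in W].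
- by exists `|x - 0|; exists 0.
- by move=> _ [y _ <-].
pose S (e : F) := [set y | W y /\ `|x - y| < d + e].
have Sn0 e : 0 < e -> S e !=set0.
  by move=> /dinf[_ [y Wy <-] ye]; exists y.
pose G := filter_from [set e : F | 0 < e] S.
have PG : ProperFilter G.
  apply: filter_from_proper; last by move=> e /Sn0.
  apply: filter_from_filter; first by exists 1 => /=.
  (* Half the harmonic mean is positive and below both [a] and [b], with no need to compare them in
     the partial order. *)
  move=> a b /= a0 b0; exists (a * b / (a + b)) => /=.
    by rewrite divr_gt0 ?mulr_gt0 ?addr_gt0.
  move=> y [Wy yab]; split; split=> //; apply: (lt_le_trans yab).
    rewrite lerD2l ler_pdivrMr ?addr_gt0// ler_pM2l//.
    by rewrite lerDr ltW.
  rewrite lerD2l ler_pdivrMr ?addr_gt0// mulrC ler_pM2l//.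
  by rewrite lerDl ltW.
(* The midpoint of [y] and [z] lies in [W], hence at distance at least [d] from [x]. The
   parallelogram law then bounds the square by [4 (d + e)^2 - 4 d^2 = e (8 d + 4 e)]. *)
have S_diam e y z : 0 < e -> e <= 1 -> S e y -> S e z ->
    `|y - z| ^+ 2 <= e * (d *+ 8 + 4).
  move=> e0 e1 [Wy yd] [Wz zd].
  have Wm : W (2^-1 *: (y + z)).
    by apply: closed_subspaceZ => //; exact: closed_subspaceD.
  have sqd u : `|x - u| < d + e -> `|x - u| ^+ 2 <= (d + e) ^+ 2.
    by move=> /ltW ud; rewrite ler_pXn2r ?nnegrE// addr_ge0// ltW.
  have md : d ^+ 2 *+ 4 <= `|(x - y) + (x - z)| ^+ 2.
    rewrite midpoint_sub normrZ ger0_norm// exprMn -natrX mulr_natl.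
    rewrite ler_wMn2r// ler_pXn2r ?nnegrE//.
    by apply: dW; exists (2^-1 *: (y + z)).
  have yzE : y - z = (x - z) - (x - y) by rewrite opprB [RHS]addrC addrA subrK.
  have -> : `|y - z| ^+ 2 =
     `|x - z| ^+ 2 *+ 2 + `|x - y| ^+ 2 *+ 2 - `|(x - y) + (x - z)| ^+ 2.
    by rewrite -parallelogram -yzE [x - z + _]addrC addrAC subrr add0r.
  apply: (@le_trans _ _ ((d + e) ^+ 2 *+ 2 + (d + e) ^+ 2 *+ 2 - d ^+ 2 *+ 4)).
    by rewrite lerB// lerD// ler_wMn2r// sqd.
  have -> : (d + e) ^+ 2 *+ 2 + (d + e) ^+ 2 *+ 2 - d ^+ 2 *+ 4 =
    e * (d *+ 8 + e * 4) by ring.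
  by rewrite ler_pM2l// lerD2l ler_piMl.
have cG : cvg G.
  apply: cauchy_cvg; apply/cauchy_ballP => eps eps0.
  have D0 : 0 < d *+ 8 + 4 by rewrite ltr_wpDl ?mulrn_wge0.
  (* This [e] satisfies both [e <= 1] and [e * D < eps ^+ 2], as [S_diam] requires. *)
  pose D := d *+ 8 + 4; pose e := eps ^+ 2 / (D + eps ^+ 2).
  have De0 : 0 < D + eps ^+ 2 by rewrite addr_gt0// exprn_gt0.
  have e0 : 0 < e by rewrite divr_gt0// exprn_gt0.
  have e1 : e <= 1 by rewrite ler_pdivrMr// mul1r lerDr ltW.
  exists (S e, S e); first by split; exists e.
  move=> [y z] [/= Sy Sz]; rewrite -ball_normE/=.
  rewrite -(@ltr_pXn2r _ 2)// ?nnegrE//; last exact: ltW.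
  apply: (le_lt_trans (S_diam _ _ _ e0 e1 Sy Sz)).
  rewrite -/D mulrAC ltr_pdivrMr// ltr_pM2l ?exprn_gt0//.
  by rewrite ltrDl exprn_gt0.
have near_lim : forall e : F, 0 < e -> exists2 y, S e y & `|lim G - y| < e.
  move=> e e0; have /(_ _ (nbhsx_ballx (lim G) e e0)) Ge : G --> lim G by [].
  have GS : G (S e) by exists e.
  have /filter_ex[y [+ Sy]] : G (ball (lim G) e `&` S e) by exact: filterI.
  by rewrite -ball_normE; exists y.
exists (lim G).
  (* [W] contains [S 1], so it belongs to the filter, and being closed it contains the limit. *)
  apply: (@closed_cvg _ _ G _ id W clW); last exact: cG.
  by exists 1 => //= y [].
move=> y Wy; apply: (@le_trans _ _ d); last by apply: dW; exists y.
(* Half of [e] pays for a near-minimizer [z], the other half for the distance from [z] to the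
   limit. *)
apply/ler_addgt0Pr => e e0; have e20 : 0 < e / 2 by rewrite divr_gt0.
have [z [Wz zd] pz] := near_lim _ e20.
rewrite -[x - _](subrKA z) [e]splitr [d + _]addrA.
apply: (le_trans (ler_normD _ _)); apply: lerD; first exact: ltW.
by rewrite distrC ltW.
Qed.

(** Moving the nearest point [p] by the component of [x - p] along [y] stays in [W] and lowers the
    squared distance by [|<x - p, y>|^2 / |y|^2], which minimality forces to be zero. *)
Lemma exists_orth_proj W x : closed_subspace W ->
  exists p, W p /\ forall y, W y -> '[x - p, y] = 0.
Proof.
move=> subW; have [p Wp pmin] := exists_nearest_point _ x subW.
exists p; split=> // y Wy; have [->|y0] := eqVneq y 0.
  exact: hdot0r.
have := pmin (p + ('[x - p, y] / '[y, y]) *: y).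
rewrite opprD addrA -(@ler_pXn2r _ 2)// ?nnegrE// norm_sub_proj//.
move=> /(_ (closed_subspaceD _ _ _ subW Wp (closed_subspaceZ _ _ _ subW Wy))).
rewrite lerBrDl gerDr pmulr_lle0 ?invr_gt0 ?exprn_gt0 ?normr_gt0//.
move=> le0; apply/eqP; rewrite -normr_eq0 -sqrf_eq0.
by rewrite eq_le le0 exprn_ge0.
Qed.

Lemma orth_projP W x : closed_subspace W ->
  W (orth_proj W x) /\ forall y, W y -> '[x - orth_proj W x, y] = 0.
Proof.
move=> /(exists_orth_proj _ x)[p Wp].
exact: (@xgetPex _ 0 [set p | W p /\ forall y, W y -> '[x - p, y] = 0]
  (ex_intro _ p Wp)).
Qed.

(** The two sides differ by the pairing of a vector of [W] with the residual of [y], which is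
    orthogonal to [W]. *)
Lemma hdot_orth_proj W x y : closed_subspace W ->
  '[orth_proj W x, orth_proj W y] = '[orth_proj W x, y].
Proof.
move=> subW; have [Wx _] := orth_projP _ x subW.
have [_ /(_ _ Wx) orthy] := orth_projP _ y subW.
apply/eqP; rewrite eq_sym -subr_eq0 -hdotBr.
by rewrite hdotC orthy rmorph0.
Qed.

Lemma orth_proj0 W : closed_subspace W -> orth_proj W (0 : H) = 0.
Proof.
move=> subW; have [Wp /(_ _ Wp)] := orth_projP _ 0 subW.
rewrite sub0r hdotNl -hdotE => /eqP.
by rewrite oppr_eq0 sqrf_eq0 normr_eq0 => /eqP.
Qed.

(** * Riesz representation and adjoints *)

(** The kernel [N] is closed. If [phi] is nonzero, some [u] orthogonal to [N] has [phi u != 0], and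
    a multiple of [u] represents [phi]. *)
Lemma riesz_representation (phi : {linear H -> F^o}) (M : F) :
  (forall x, `|phi x| <= M * `|x|) -> exists z, forall x, phi x = '[x, z].
Proof.
move=> bphi.
have cphi : continuous phi.
  apply/bounded_linear_continuous/linear_boundedP.
  (* [M] itself need not be real if [H] is trivial, but [M] times the norm of [x] dominates a norm,
     so it is nonnegative and [M] may be replaced by its absolute value. *)
  exists `|M|; split; first exact: normr_real.
  move=> r Mr x; apply: (le_trans (bphi x)).
  have Mx : 0 <= M * `|x| := le_trans (normr_ge0 _) (bphi x).
  by rewrite -(ger0_norm Mx) normrM normr_id ler_wpM2r// ltW.
pose N := phi @^-1` [set 0].
have subN : closed_subspace N.
  split; last 2 first.
  - exact: linear0.
  - by move=> a x y; rewrite /N/= linearP => -> ->; rewrite scaler0 addr0.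
  apply: closed_comp; [by move=> x _; exact: cphi|].
  exact/accessible_closed_set1/hausdorff_accessible/norm_hausdorff.
have [phi0|] := pselect (forall x, phi x = 0).
  by exists 0 => x; rewrite phi0 hdot0r.
move=> /existsNP[x0 /eqP phix0].
have [p [Np orthp]] := exists_orth_proj _ x0 subN.
pose u := x0 - p.
have phiu : phi u != 0 by rewrite /u linearB (_ : phi p = 0)// subr0.
have uu : '[u, u] != 0.
  rewrite -hdotE expf_neq0// normr_eq0; apply: contra_neq phiu => ->.
  exact: linear0.
(* The coefficient is conjugated because [hdot] is conjugate-linear in its second argument. *)
exists (scalar_conj R k (phi u / '[u, u]) *: u) => x.
rewrite hdotZr scalar_conjK.
(* [phi] kills this combination, so it lies in [N]; solving the orthogonality relation for [phi x]
   gives the formula. *)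
have : '[u, phi u *: x - phi x *: u] = 0.
  apply: orthp; rewrite /N/= linearB !linearZ/=.
  by rewrite scalerN; apply/eqP; rewrite subr_eq0; apply/eqP; exact: mulrC.
rewrite hdotC => /(congr1 (scalar_conj R k)); rewrite scalar_conjK rmorph0.
rewrite hdotBl !hdotZl => /eqP; rewrite subr_eq0 => /eqP e.
by rewrite mulrAC e mulfK.
Qed.

(** By Cauchy-Schwarz, pairing [T x] with [y] is a functional of [x] bounded by [M] times the norm
    of [y]; Riesz makes the set in [adjoint] nonempty. *)
Lemma adjointP (T : {linear H -> H}) y : bounded_operator T ->
  forall x, '[T x, y] = '[x, adjoint T y].
Proof.
move=> [M bT].
have phiP : linear (fun x => '[T x, y] : F^o).
  by move=> a u v; rewrite linearP hdotDl hdotZl.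
pose phi : {linear H -> F^o} := HB.pack (fun x => '[T x, y] : F^o)
  (GRing.isLinear.Build _ _ _ _ _ phiP).
have [x|z phiz] := @riesz_representation phi (M * `|y|).
  rewrite (le_trans (hdot_cauchy_schwarz _ _))//.
  by rewrite mulrAC ler_wpM2r.
exact: (@xgetPex _ 0 [set z | forall x, '[T x, y] = '[x, z]]
  (ex_intro _ z phiz)).
Qed.

Lemma hdot_adjointl (T : {linear H -> H}) x y : bounded_operator T ->
  '[adjoint T x, y] = '[x, T y].
Proof. by move=> bT; rewrite hdotC -adjointP// -hdotC. Qed.

(** * Additivity of unconditional sums *)

Section sums.
Context {I : countType}.
Implicit Types a b : I -> F.

Lemma cvg_partial_sumD a b : summable_over a -> summable_over b ->
  partial_sum ((fun i => a i + b i) : I -> F^o) @ totally -->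
  (sum_over a + sum_over b : F^o).
Proof.
move=> sa sb.
rewrite (_ : partial_sum _ = (partial_sum (a : I -> F^o)) \+
  (partial_sum (b : I -> F^o))); last first.
  by apply/funext => J; rewrite /partial_sum big_split.
have totally_proper := @totally_filter I.
exact: (cvgD sa sb).
Qed.

Lemma summable_overD a b : summable_over a -> summable_over b ->
  summable_over (fun i => a i + b i).
Proof. by move=> sa sb; apply/cvg_ex; eexists; exact: cvg_partial_sumD. Qed.

Lemma sum_overD a b : summable_over a -> summable_over b ->
  sum_over (fun i => a i + b i) = sum_over a + sum_over b.
Proof.
move=> sa sb; have totally_proper := @totally_filter I.
by apply: cvg_lim; [exact: norm_hausdorff|exact: cvg_partial_sumD].
Qed.

End sums.

(** * Perturbation of the controlled sums *)

Lemma controlled_terms_perturb (I : countType) (C C' : {linear H -> H})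
    (W V : I -> set H) (w : I -> F) (f : H) :
  bounded_operator C' ->
  (forall i, closed_subspace (W i)) -> (forall i, closed_subspace (V i)) ->
  controlled_terms C C' V w f = (fun i => controlled_terms C C' W w f i +
    w i ^+ 2 *
      '[adjoint C' (orth_proj (V i) (C f) - orth_proj (W i) (C f)), f]).
Proof.
move=> bC' subW subV; apply/funext => i; rewrite /controlled_terms.
rewrite !hdot_orth_proj// hdot_adjointl// hdotBl -mulrDr.
by rewrite addrC subrK.
Qed.

(** Serves the case [f = 0], which the strict perturbation inequality excludes. *)
Lemma controlled_terms0 (I : countType) (C C' : {linear H -> H})
    (W : I -> set H) (w : I -> F) :
  (forall i, closed_subspace (W i)) -> controlled_terms C C' W w 0 = fun=> 0.
Proof.
move=> subW; apply/funext => i; rewrite /controlled_terms !linear0.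
by rewrite orth_proj0// hdot0l mulr0.
Qed.

End hilbert.

Theorem proposition4p1 (R : realType) (k : scalar_kind) (H : hilbertSpace R k)
    (I : countType) (K C C' : {linear H -> H}) (W V : I -> set H)
    (w : I -> scalars R k) (A B : scalars R k)
    (sepH : separable_space H)
    (bK : bounded_operator K) (clK : closed (range K))
    (invC : boundedly_invertible C) (invC' : boundedly_invertible C')
    (subW : forall i, closed_subspace (W i)) (w_gt0 : forall i, 0 < w i)
    (frameW : controlled_K_fusion_frame_on setT K C C' W w A B)
    (subV : forall i, closed_subspace (V i))
    (perturb : exists r : scalars R k,
      [/\ 0 < r, r < A &
        forall f : H, f != 0 ->
          let t := fun i : I => w i ^+ 2 *
            '[adjoint C' (orth_proj (V i) (C f) - orth_proj (W i) (C f)), f] in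
          [/\ summable_over t, 0 < sum_over t & sum_over t <= r * `|f| ^+ 2]]) :
  controlled_bessel_K_fusion C C' V w /\
  exists A' B' : scalars R k,
    controlled_K_fusion_frame_on (range K) K C C' V w A' B'.
Proof.
have [bC' _] := invC'; have [A0 [AB frW]] := frameW.
have [r [r0 rA pert]] := perturb.
have B0 : 0 < B := lt_le_trans A0 AB.
(* Comparing with the sum for [W] keeps its lower bound available, while the upper bound serves both
   conclusions. *)
have frV f : [/\ summable_over (controlled_terms C C' V w f),
    sum_over (controlled_terms C C' W w f) <=
      sum_over (controlled_terms C C' V w f) &
    sum_over (controlled_terms C C' V w f) <= (B + r) * `|f| ^+ 2].
  have [sW _ leB] := frW f Logic.I.
  have [f0|/pert[st t0 tr]] := eqVneq f 0.
    suff <- : controlled_terms C C' W w f = controlled_terms C C' V w f.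
      split=> //; apply: (le_trans leB).
      by rewrite f0 normr0 expr0n !mulr0.
    by rewrite f0 !controlled_terms0.
  rewrite (controlled_terms_perturb I C C' W V)//.
  split; first exact: summable_overD.
  - by rewrite sum_overD// lerDl ltW.
  - by rewrite sum_overD// mulrDl lerD.
split.
  by exists (B + r); split=> [|f]; [exact: addr_gt0|case: (frV f)].
exists A, (B + r); split=> //; split; first by rewrite ler_wpDr// ltW.
move=> f _; have [sV leV Vle] := frV f; have [_ leA _] := frW f Logic.I.
by split=> //; exact: le_trans leV.
Qed.
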